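(* Let $V$ be a finite-dimensional real vector space with basis $S$, and let $U\subseteq V$ be any subspace. Then $S$ contains a spanning tree $T$ of $V$ with respect to $U$; its fundamental cycles form a basis of $U$ and its fundamental cuts form a basis of $U^\perp$.
   Context: Equip $V$ with the inner product $\langle\,,\rangle$ for which $S$ is orthonormal ($\langle s,s'\rangle=\delta_{ss'}$), and let $U^\perp$ be the orthogonal complement of $U$. A set $T\subseteq S$ is a spanning tree of $V$ with respect to $U$ (and $S$) if (1) $U^\perp$ has a basis $(x_t\mid t\in T)$ with $\langle x_t,t'\rangle=\delta_{tt'}$ for all $t,t'\in T$, and (2) $U$ has a basis $(x_s\mid s\in S\setminus T)$ with $\langle x_s,s'\rangle=\delta_{ss'}$ for all $s,s'\in S\setminus T$. The $x_t$ are the fundamental cuts and the $x_s$ the fundamental cycles of $T$. *)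

(* Defs.v *)
From HB Require Import structures.
From mathcomp Require Import all_boot all_order all_algebra.
From mathcomp Require Import sesquilinear finmap reals.

Set Implicit Arguments.
Unset Strict Implicit.
Unset Printing Implicit Defensive.

Import Order.TTheory GRing.Theory Num.Theory.
Local Open Scope ring_scope.
Local Open Scope fset_scope.

Section SpanningTree.
Variables (R : realType) (V : vectType R) (S : {fset V}).
Implicit Types (U W : {vspace V}) (T B : {fset V}).

(* When S is a basis of V, this is the inner product for which S is
   orthonormal: see inner_orthonormal, inner_gt0 and inner_unique. *)
Definition inner (u v : V) : R :=
  \sum_(i < size S) coord (in_tuple S) i u * coord (in_tuple S) i v.

Fact inner_is_bilinear :
  bilinear_for (GRing.Scale.Law.clone _ _ *%R _)
               (GRing.Scale.Law.clone _ _ (idfun \; *%R) _) inner.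
Proof.
split=> [w|w] a u v; rewrite /inner /= mulr_sumr -big_split /=.
  by apply: eq_bigr => i _; rewrite linearP mulrDl mulrA.
by apply: eq_bigr => i _; rewrite linearP mulrDr mulrCA.
Qed.

HB.instance Definition _ :=
  bilinear_isBilinear.Build R V V R _ _ inner inner_is_bilinear.

Fact inner_is_symmetric (u v : V) :
  inner u v = (-1) ^+ false * idfun (inner v u).
Proof.
by rewrite expr0 mul1r; apply: eq_bigr => i _; rewrite mulrC.
Qed.

HB.instance Definition _ :=
  isHermitianSesquilinear.Build R V false idfun inner inner_is_symmetric.

Lemma inner_orthonormal : basis_of {:V} S ->
  {in S &, forall s s', inner s s' = (s == s')%:R}.
Proof.
move=> bS _ _ /(nthP 0)[i ltiS <-] /(nthP 0)[j ltjS <-].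
have fS : free (in_tuple S) := basis_free bS.
rewrite nth_uniq ?fset_uniq //.
pose i' := Ordinal ltiS; pose j' := Ordinal ltjS.
rewrite /inner (bigD1 i') //= big1 => [|k ne_ki].
  by rewrite (coord_free i' i') // (coord_free j' i') // eqxx mul1r addr0 eq_sym.
by rewrite (coord_free i' k) // eq_sym (negPf ne_ki) mul0r.
Qed.

Lemma inner_gt0 : basis_of {:V} S -> forall v, v != 0 -> 0 < inner v v.
Proof.
move=> bS v v0; rewrite lt_neqAle eq_sym sumr_ge0 => [|i _]; last first.
  by rewrite -expr2 sqr_ge0.
rewrite andbT; apply: contraNneq v0 => /eqP.
rewrite psumr_eq0 => [/allP c0|i _]; last by rewrite -expr2 sqr_ge0.
rewrite (coord_basis (X := in_tuple S) bS (memvf v)) big1 // => i _.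
have /= := c0 i (mem_index_enum i); rewrite mulf_eq0 orbb => /eqP ->.
by rewrite scale0r.
Qed.

Lemma inner_unique (f : {bilinear V -> V -> R | *%R & *%R}) :
    basis_of {:V} S -> {in S &, forall s s', f s s' = (s == s')%:R} ->
  f =2 inner.
Proof.
move=> bS fS u v.
have dS := fun w => coord_basis (X := in_tuple S) bS (memvf w).
have uS : uniq S := fset_uniq S.
have nS (i : 'I_(size S)) : nth 0 S i \in S by rewrite mem_nth.
rewrite {1}(dS u) linear_sumlz /inner; apply: eq_bigr => i _ /=.
rewrite linearZl_LR /= {1}(dS v) linear_sumr (bigD1 i) //= big1 => [|j ne_ji].
  by rewrite linearZr_LR /= fS // eqxx mulr1 addr0.
by rewrite linearZr_LR /= fS // nth_uniq // eq_sym (inj_eq val_inj) (negPf ne_ji) mulr0.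
Qed.

(* A basis (x b | b in B) of W, indexed by the set B and dual to it; the values
   of x outside B are irrelevant. *)
Definition fundamental_family W B (x : V -> V) : Prop :=
  basis_of W [seq x b | b <- B] /\
  {in B &, forall b b', inner (x b) b' = (b == b')%:R}.

(* This is what allows one to speak of "the" fundamental cuts and cycles. *)
Lemma fundamental_family_unique W B x y :
  fundamental_family W B x -> fundamental_family W B y -> {in B, x =1 y}.
Proof.
move=> [bx dx] [by_ dy] _ /(nthP 0)[k ltkB <-]; pose k' := Ordinal ltkB.
have uB : uniq B := fset_uniq B.
have nB (i : 'I_(size B)) : nth 0 B i \in B by rewrite mem_nth.
pose X := map_tuple x (in_tuple B).
have expand w : w \in W ->
    w = \sum_(i < size B) inner w (nth 0 B i) *: x (nth 0 B i).
  move=> wW.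
  have dw : w = \sum_(i < size B) coord X i w *: x (nth 0 B i).
    rewrite [LHS](coord_basis (X := X) bx wW); apply: eq_bigr => i _.
    by rewrite (nth_map 0).
  rewrite [LHS]dw; apply: eq_bigr => j _; congr (_ *: _).
  rewrite [in RHS]dw linear_sumlz (bigD1 j) //= big1 => [|i ne_ij].
    by rewrite linearZl_LR /= dx // eqxx mulr1 addr0.
  by rewrite linearZl_LR /= dx // nth_uniq // (inj_eq val_inj) (negPf ne_ij) mulr0.
have yW : y (nth 0 B k) \in W by rewrite (basis_mem by_) // map_f ?(nB k').
rewrite [RHS]expand // (bigD1 k') //= big1 => [|i ne_ik].
  by rewrite dy ?(nB k') // eqxx scale1r addr0.
rewrite dy ?(nB k') // nth_uniq // eq_sym.
by rewrite -[_ == _]/(i == k') (negPf ne_ik) scale0r.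
Qed.

Definition fundamental_cuts U T : (V -> V) -> Prop :=
  fundamental_family (orthov inner U) T.

Definition fundamental_cycles U T : (V -> V) -> Prop :=
  fundamental_family U (S `\` T).

Definition spanning_tree U T : Prop :=
  [/\ T `<=` S,
      exists x, fundamental_cuts U T x
    & exists x, fundamental_cycles U T x].

End SpanningTree.

(* Main.v *)
Require Import Defs.
From HB Require Import structures.
From mathcomp Require Import all_boot all_order all_algebra.
From mathcomp Require Import sesquilinear finmap reals.

(** Let [T] be a subset of [S] whose span is a complement of [U]. The projection
    of [s] to [U] along the span of [T] differs from [s] by an element of that
    span, so these projections, for [s] in [S] minus [T], form a family in [U]
    dual to [S] minus [T]. The matrix of the cuts is minus the transpose of the
    matrix of the cycles. A family in [W] dual to [B] is a basis of [W] as soon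
    as no nonzero vector of [W] is orthogonal to [B]: for the cycles because
    such a vector would lie in both [U] and the span of [T], for the cuts
    because it would be orthogonal to [U] and [T], hence to everything. *)

Set Implicit Arguments.
Unset Strict Implicit.
Unset Printing Implicit Defensive.

Import Order.TTheory GRing.Theory Num.Theory.
Local Open Scope ring_scope.
Local Open Scope fset_scope.

(** Greedy selection along [s]: a vector is kept exactly when it lies outside the sum of [U] and the
    span of the vectors kept so far. *)
Lemma span_complement (K : fieldType) (V : vectType K) (U : {vspace V})
    (s : seq V) :
  exists T : {fset V}, [/\ {subset T <= s}, (<<s>> <= U + <<T>>)%VS
                         & (U :&: <<T>> = 0)%VS].
Proof.
elim: s => [|a s [T [Ts sUT UT0]]].
  by exists fset0; rewrite !span_nil sub0v capv0; split.
have [aUT|aUT] := boolP (a \in U + <<T>>)%VS.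
  exists T; split=> // [t /Ts ts|]; first by rewrite inE ts orbT.
  by rewrite span_cons subv_add -memvE aUT.
have spanT : (<<a |` T>> = <[a]> + <<T>>)%VS.
  by rewrite -span_cons; apply: eq_span => x; rewrite !inE.
exists (a |` T); rewrite spanT; split=> [t||].
- by rewrite !inE => /predU1P[->|/Ts->]; rewrite ?eqxx ?orbT.
- by rewrite span_cons addvA (addvC U) -addvA addvS.
apply/eqP; rewrite -subv0; apply/subvP => u.
rewrite memv_cap => /andP[uU /memv_addP[_ /vlineP[k ->] [t tT Du]]].
have [k0|k0] := eqVneq k 0.
  by rewrite -UT0 memv_cap uU Du k0 scale0r add0r.
(* With [k] nonzero, [u = k *: a + t] can be solved for [a], against the choice of [a]. *)
case/negP: aUT; suff <-: k^-1 *: u - k^-1 *: t = a.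
  by rewrite memv_add ?memvN ?memvZ.
by rewrite Du scalerDr scalerA mulVf // scale1r addrK.
Qed.

Section DualFamily.
Variables (R : realType) (V : vectType R) (S : {fset V}).
Implicit Types (U W : {vspace V}) (T B : {fset V}) (x : V -> V).

Local Notation dot := (inner S).

Lemma innerC u v : dot u v = dot v u.
Proof. by rewrite inner_is_symmetric mul1r. Qed.

Lemma mem_orthov_span (X : seq V) u :
  {in X, forall v, dot u v = 0} -> u \in orthov dot <<X>>.
Proof.
move=> uX; rewrite memvE orthov_sym; apply/span_subvP => v vX.
by rewrite mem_orthov1 /= innerC uX.
Qed.

Lemma sum_delta B (k : V -> R) b :
  b \in B -> \sum_(c <- B) k c * (c == b)%:R = k b.
Proof.
move=> bB; rewrite (big_rem b) //= eqxx mulr1 big_seq big1 ?addr0 // => c.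
by rewrite mem_rem_uniq ?fset_uniq // inE => /andP[/negPf-> _]; rewrite mulr0.
Qed.

(** The difference of the two sides lies in [W] and, by duality, is orthogonal to [B]. *)
Lemma dual_family_expand W B x :
    {in B, forall b, x b \in W} ->
    {in B &, forall b b', dot (x b) b' = (b == b')%:R} ->
    (W :&: orthov dot <<B>> = 0)%VS ->
  {in W, forall w, w = \sum_(b <- B) dot w b *: x b}.
Proof.
move=> xW dx WB0 w wW; apply/eqP; rewrite -subr_eq0 -memv0 -WB0 memv_cap.
rewrite memvB //=; last by rewrite big_seq memv_suml // => b /xW; apply: memvZ.
apply: mem_orthov_span => b bB.
rewrite linearBl /= linear_sumlz; apply/eqP; rewrite subr_eq0 eq_sym; apply/eqP.
rewrite -[RHS](sum_delta _ bB) big_seq [RHS]big_seq; apply: eq_bigr => c cB.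
by rewrite linearZl_LR /= dx.
Qed.

(** Here [B] is a sequence so that induction applies. *)
Lemma dual_family_free (B : seq V) x :
    uniq B -> {in B &, forall b b', dot (x b) b' = (b == b')%:R} ->
  free [seq x b | b <- B].
Proof.
elim: B => [|a B IHB] /=; first by rewrite nil_free.
move=> /andP[aB uB] dx; rewrite free_cons IHB // => [|b c bB cB]; last first.
  by rewrite dx // inE ?bB ?cB orbT.
rewrite andbT; apply/negP => xaB.
(* Pairing with [a] kills every [x b] with [b] in the tail, but takes the value 1 on [x a]. *)
suff /subvP/(_ _ xaB) : (<<[seq x b | b <- B]>> <= orthov dot <[a]>)%VS.
  by rewrite mem_orthov1 /= dx ?mem_head // eqxx oner_eq0.
apply/span_subvP => _ /mapP[b bB ->].
rewrite mem_orthov1 /= dx ?mem_head // ?inE ?bB ?orbT //.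
by rewrite pnatr_eq0 eqb0; apply: contraNneq aB => <-.
Qed.

Lemma dual_family_fundamental W B x :
    {in B, forall b, x b \in W} ->
    {in B &, forall b b', dot (x b) b' = (b == b')%:R} ->
    (W :&: orthov dot <<B>> = 0)%VS ->
  fundamental_family S W B x.
Proof.
move=> xW dx WB0; split=> //; apply/andP; split; last first.
  exact: dual_family_free (fset_uniq B) dx.
rewrite eqEsubv; apply/andP; split.
  by apply/span_subvP => _ /mapP[b bB ->]; apply: xW.
apply/subvP => w /(dual_family_expand xW dx WB0) ->.
by rewrite big_seq memv_suml // => b bB; rewrite memvZ // memv_span // map_f.
Qed.

Hypothesis bS : basis_of {:V} S.

Lemma capv_orthov U : (U :&: orthov dot U = 0)%VS.
Proof.
apply/eqP; rewrite -subv0; apply/subvP => v.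
rewrite memv_cap => /andP[vU /mem_orthovP/(_ v vU) v0].
by rewrite memv0; apply: contraTT isT => /(inner_gt0 bS); rewrite v0 ltxx.
Qed.

(** An orthonormal basis is its own dual family. *)
Lemma inner_expand v : v = \sum_(s <- S) dot v s *: s.
Proof.
apply: (dual_family_expand (x := id) _ _ _ (memvf v)) => [s _||].
- exact: memvf.
- exact: inner_orthonormal.
by rewrite (span_basis bS) capv_orthov.
Qed.

Variables (U : {vspace V}) (T : {fset V}).
Hypotheses (TS : T `<=` S) (UTf : (U + <<T>> = fullv)%VS).
Hypothesis UT0 : (U :&: <<T>> = 0)%VS.

Let cycle (s : V) : V := addv_pi1 U <<T>> s.

Let cut (t : V) : V := t - \sum_(s <- S `\` T) dot (cycle s) t *: s.

Let memDS s : s \in S `\` T -> s \in S.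
Proof. by rewrite inE => /andP[]. Qed.

Let memTS t : t \in T -> t \in S.
Proof. exact: (fsubsetP TS). Qed.

Let spanT_orthov : (<<T>> <= orthov dot <<S `\` T>>)%VS.
Proof.
apply/span_subvP => t tT; apply: mem_orthov_span => s sD.
rewrite (inner_orthonormal bS (memTS tT) (memDS sD)).
by move: sD; rewrite inE => /andP[sT _]; case: eqP sT => // <-; rewrite tT.
Qed.

Let inner_T_DT t s : t \in T -> s \in S `\` T -> dot t s = 0.
Proof. by move=> /memv_span/(subvP spanT_orthov)/mem_orthovP tD /memv_span/tD. Qed.

Let cycle_dual : {in S `\` T &, forall s s', dot (cycle s) s' = (s == s')%:R}.
Proof.
move=> s s' sD s'D; have sUT : s \in (U + <<T>>)%VS by rewrite UTf memvf.
rewrite -(inner_orthonormal bS (memDS sD) (memDS s'D)).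
(* Only the component of [s] in the span of [T] is lost, and it is orthogonal to [s']. *)
rewrite -[in RHS](addv_pi1_pi2 sUT) linearDl /=.
have /(subvP spanT_orthov)/mem_orthovP -> := memv_pi2 U <<T>> s; last first.
  exact: memv_span.
by rewrite addr0.
Qed.

Let capU_orthovD : (U :&: orthov dot <<S `\` T>> = 0)%VS.
Proof.
apply/eqP; rewrite -subv0; apply/subvP => u.
rewrite memv_cap => /andP[uU /mem_orthovP uD]; rewrite -UT0 memv_cap uU /=.
(* The coefficients of [u] outside [T] vanish, so [u] lies in the span of [T]. *)
rewrite (inner_expand u) big_seq memv_suml // => s sS.
have [sT|sT] := boolP (s \in T); first by rewrite memvZ ?memv_span.
by rewrite uD ?scale0r ?mem0v // memv_span // inE sT.
Qed.

Let cycleU : {in S `\` T, forall s, cycle s \in U}.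
Proof. by move=> s _; apply: memv_pi1. Qed.

Let cycle_fundamental : fundamental_cycles S U T cycle.
Proof. exact: dual_family_fundamental. Qed.

Let cut_fundamental : fundamental_cuts S U T cut.
Proof.
apply: dual_family_fundamental => [t tT|t t' tT t'T|].
- apply/mem_orthovP => u uU.
  (* The cycles span [U], so it suffices to pair [cut t] with each [cycle s]; the coefficients in
     [cut] are chosen to cancel [dot (cycle s) t]. *)
  rewrite (dual_family_expand cycleU cycle_dual capU_orthovD uU).
  rewrite linear_sumr big_seq big1 // => s sD.
  rewrite linearZr_LR /= (innerC (cut t)) linearBr /= linear_sumr.
  suff -> : \sum_(r <- S `\` T) dot (cycle s) (dot (cycle r) t *: r) =
            dot (cycle s) t by rewrite subrr mulr0.
  rewrite -[RHS](sum_delta (fun r => dot (cycle r) t) sD) big_seq [RHS]big_seq.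
  by apply: eq_bigr => r rD; rewrite linearZr_LR /= (cycle_dual sD rD) eq_sym.
- rewrite linearBl /= linear_sumlz big_seq big1 => [|s sD].
    by rewrite subr0 (inner_orthonormal bS) ?memTS.
  by rewrite linearZl_LR /= (innerC s) (inner_T_DT t'T sD) mulr0.
apply/eqP; rewrite -subv0 -(capv_orthov fullv) capfv -UTf; apply/subvP => w.
(* By symmetry both conditions say that a subspace lies in the orthogonal complement of [w], so they
   combine into one on [U + <<T>>]. *)
by rewrite memv_cap !memvE ![(<[w]> <= _)%VS]orthov_sym -subv_add.
Qed.

Lemma complement_spanning_tree : spanning_tree S U T.
Proof. by split; [|exists cut|exists cycle]. Qed.

End DualFamily.

Theorem theorem8 (R : realType) (V : vectType R) (S : {fset V})
    (U : {vspace V}) :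
  basis_of {:V} S ->
  exists T : {fset V},
    [/\ spanning_tree S U T,
        forall x : V -> V, fundamental_cycles S U T x ->
          basis_of U [seq x s | s <- (S `\` T)%fset]
      & forall x : V -> V, fundamental_cuts S U T x ->
          basis_of (orthov (inner S) U) [seq x t | t <- T]].
Proof.
move=> bS; have [T [TS sUT UT0]] := span_complement U S.
(* The two basis claims are the first component of [fundamental_family]. *)
exists T; split=> [|x []|x []] //.
apply: complement_spanning_tree => //; first exact/fsubsetP.
by apply/eqP; rewrite eqEsubv subvf -(span_basis bS).
Qed.
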